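(* Fix $L \ge \alpha > 0$ and $\delta \in (0, \frac{1}{2}]$. There are boolean functions $f_1, f_2, \ldots$ such that: (1) $f_k$ is computable by a decision tree of depth $O(k/\delta)$; (2) for every $\delta$-balanced product distribution $\mathcal{D}$ over the domain of $f_k$ and every $(\alpha, L)$-impurity function $\mathscr{G}$, any $\mathscr{G}$-impurity-based decision tree learning algorithm, when learning $f_k$ on $\mathcal{D}$, returns a tree that has either depth $\ge 2^k$ or an $\Omega(\delta)$ error.
   Context: **Boolean functions and error.** Each $f_k$ is a function from $\{0,1\}^{n}$ to $\{0,1\}$ for some $n$ depending on $k$. The error of a decision tree $T$ is its error as a hypothesis for $f_k$ over $\mathcal{D}$, i.e. $\Pr_{x \sim \mathcal{D}}[T(x) \ne f_k(x)]$. **Impurity functions.** An impurity function is a concave function $\mathscr{G} : [0,1] \to [0,1]$ that is symmetric around $\frac12$ and satisfies $\mathscr{G}(0) = \mathscr{G}(1) = 0$ and $\mathscr{G}(\frac12) = 1$. It is an $(\alpha, L)$-impurity function if it is $\alpha$-strongly concave and $L$-smooth, i.e. it is twice differentiable and $\mathscr{G}''(t) \in [-L, -\alpha]$ for every $t \in [0,1]$. **Balanced distributions.** A product distribution over $\{0,1\}^n$ is $\delta$-balanced if the expectation of each of the $n$ coordinates lies in $[\delta, 1-\delta]$. **Restrictions.** A restriction $\pi$ is a list of constraints of the form ''$x_i = b$'' in which every index $i$ appears at most once. For $f : \{0,1\}^n \to \{0,1\}$, the restricted function $f_\pi : \{0,1\}^n \to \{0,1\}$ is $f_\pi(x) = f(x')$,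 where $x'$ is obtained from $x$ by overwriting the coordinates in $\pi$ with the prescribed values; in particular $f_{x_i = b}(x)$ is $f$ evaluated at $x$ with the $i$-th bit set to $b$. **Purity gain.** For a distribution $\mathcal{D}$ over $\{0,1\}^n$ with $p_i = \Pr_{x \sim \mathcal{D}}[x_i = 1]$, $$\mathscr{G}\text{-purity-gain}_{\mathcal{D}}(f, x_i) := \mathscr{G}\big(\mathbb{E}_{x\sim\mathcal{D}}[f(x)]\big) - p_i\, \mathscr{G}\big(\mathbb{E}_{x\sim\mathcal{D}}[f_{x_i=1}(x)]\big) - (1-p_i)\, \mathscr{G}\big(\mathbb{E}_{x\sim\mathcal{D}}[f_{x_i=0}(x)]\big).$$ **Impurity-based algorithms.** Decision trees query a single variable at each internal node and have leaves labeled by bits; depth is the maximum number of queries on a root-to-leaf path. Each node $v$ corresponds to the restriction $\pi_v$ formed by the queries (and their answers) at the ancestors of $v$, excluding $v$ itself, and $f_v := f_{\pi_v}$. A decision tree learning algorithm is $\mathscr{G}$-impurity-based if for every $f : \{0,1\}^n\to\{0,1\}$ and every distribution $\mathcal{D}$ over $\{0,1\}^n$, when learning $f$ on $\mathcal{D}$ it outputs a decision tree such that for every internal node $v$, the variable $x_i$ queried at $v$ satisfies $\mathscr{G}\text{-purity-gain}_{\mathcal{D}}(f_v, x_i) \ge \mathscr{G}\text{-purity-gain}_{\mathcal{D}}(f_v, x_j)$ for every $j \in [n]$. *)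

(* Defs.v *)
From mathcomp Require Import all_boot all_order all_algebra.
From mathcomp Require Import all_classical all_reals all_analysis.
Set Implicit Arguments.
Unset Strict Implicit.
Unset Printing Implicit Defensive.
Import Order.TTheory GRing.Theory Num.Theory.
Import numFieldNormedType.Exports.
Local Open Scope classical_set_scope.
Local Open Scope ring_scope.

Definition cube (n : nat) : finType := {ffun 'I_n -> bool}.

Definition restriction (n : nat) := seq ('I_n * bool).

Definition overwrite_bit n (x : cube n) (i : 'I_n) (b : bool) : cube n :=
  [ffun j => if j == i then b else x j].

(* A restriction constrains each index at most once; on lists with a repeated
   index the earliest constraint on that index takes precedence. *)
Definition overwrite n (pi : restriction n) (x : cube n) : cube n :=
  foldr (fun c y => overwrite_bit y c.1 c.2) x pi.

Definition restrict_fun n (f : cube n -> bool) (pi : restriction n) :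
    cube n -> bool :=
  fun x => f (overwrite pi x).

(* [Node i T0 T1] queries [x_i] and continues in [T0] if [x_i = 0] and in [T1]
   if [x_i = 1]. A path may query a variable repeatedly; pruning the redundant
   queries yields a read-once tree for the same function, no deeper. *)
Inductive dtree (n : nat) : Type :=
| Leaf of bool
| Node of 'I_n & dtree n & dtree n.
Arguments Leaf {n}.
Arguments Node {n}.

Fixpoint tree_eval n (T : dtree n) (x : cube n) : bool :=
  match T with
  | Leaf b => b
  | Node i T0 T1 => if x i then tree_eval T1 x else tree_eval T0 x
  end.

Fixpoint tree_depth n (T : dtree n) : nat :=
  match T with
  | Leaf _ => 0
  | Node _ T0 T1 => (maxn (tree_depth T0) (tree_depth T1)).+1
  end.

(* The pairs [(pi_v, i)], for every internal node [v] of [T] with query [x_i],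
   when the root of [T] has restriction [pi]; constraints are listed from the
   root downwards. *)
Fixpoint internal_nodes n (pi : restriction n) (T : dtree n) :
    seq (restriction n * 'I_n) :=
  match T with
  | Leaf _ => [::]
  | Node i T0 T1 =>
      (pi, i) :: internal_nodes (rcons pi (i, false)) T0
              ++ internal_nodes (rcons pi (i, true)) T1
  end.

Record dist (R : realType) (n : nat) := Dist {
  pmf :> cube n -> R ;
  pmf_ge0 : forall x, 0 <= pmf x ;
  pmf_sum1 : \sum_(x : cube n) pmf x = 1
}.

Definition prob (R : realType) n (D : dist R n) (A : pred (cube n)) : R :=
  \sum_(x | A x) D x.

Definition expect (R : realType) n (D : dist R n) (g : cube n -> bool) : R :=
  \sum_x D x * (g x)%:R.

Definition tree_error (R : realType) n (D : dist R n) (f : cube n -> bool)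
    (T : dtree n) : R :=
  prob D (fun x => tree_eval T x != f x).

Definition product_dist (R : realType) n (D : dist R n) : Prop :=
  forall x : cube n, D x = \prod_(i < n) prob D (fun y => y i == x i).

Definition balanced (R : realType) n (delta : R) (D : dist R n) : Prop :=
  product_dist D /\
  forall i : 'I_n, delta <= expect D (fun x => x i) <= 1 - delta.

(* Impurity functions are total functions on [R] of which only the values on
   [0, 1] matter: derivatives are taken within [0, 1], hence one-sided at the
   endpoints. *)
Definition has_deriv01 (R : realType) (f : R -> R) (t l : R) : Prop :=
  (fun s : R => (f s - f t) / (s - t)) @ within `[0, 1] (dnbhs t) --> l.

Definition impurity (R : realType) (G : R -> R) : Prop :=
  [/\ convex_function (`[0, 1] : set R^o) (fun t : R^o => - G t : R^o),
      forall t : R, t \in `[0, 1]%R -> G t \in `[0, 1]%R,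
      forall t : R, t \in `[0, 1]%R -> G (1 - t) = G t,
      G 0 = 0 /\ G 1 = 0 &
      G (2^-1) = 1].

Definition smooth_impurity (R : realType) (alpha L : R) (G : R -> R) : Prop :=
  impurity G /\
  exists G' G'' : R -> R, forall t : R, t \in `[0, 1]%R ->
    [/\ has_deriv01 G t (G' t),
        has_deriv01 G' t (G'' t) &
        - L <= G'' t <= - alpha].

Definition purity_gain (R : realType) n (G : R -> R) (D : dist R n)
    (f : cube n -> bool) (i : 'I_n) : R :=
  let p := prob D (fun x => x i) in
  G (expect D f)
  - p * G (expect D (restrict_fun f [:: (i, true)]))
  - (1 - p) * G (expect D (restrict_fun f [:: (i, false)])).

Definition max_gain_tree (R : realType) n (G : R -> R) (D : dist R n)
    (f : cube n -> bool) (T : dtree n) : Prop :=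
  forall pi i, (pi, i) \in internal_nodes [::] T ->
  forall j, purity_gain G D (restrict_fun f pi) j
            <= purity_gain G D (restrict_fun f pi) i.

Definition learner (R : realType) :=
  forall n, (cube n -> bool) -> dist R n -> dtree n.

Definition impurity_based (R : realType) (G : R -> R) (A : learner R) : Prop :=
  forall n (f : cube n -> bool) (D : dist R n), max_gain_tree G D f (A n f D).

(* Main.v *)
Require Import Defs.
From mathcomp Require Import all_boot all_order all_algebra.
From mathcomp Require Import all_classical all_reals normedtype.
Import numFieldNormedType.Exports.
From mathcomp Require Import all_analysis.
From mathcomp Require Import ring lra zify.
Set Implicit Arguments.
Unset Strict Implicit.
Unset Printing Implicit Defensive.
Import Order.TTheory GRing.Theory Num.Theory.
Local Open Scope ring_scope.

(* The hard function is f(x, z) = z_{Mx}: M : F_2^m -> F_2^(k+1) is linear and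
   z has one slot for each of the 2^(k+1) addresses. An averaging argument over
   M gives a code for which the characters of the address Mx have total weight
   2^(- Omega(k)) already for m = O(k / delta), so under every delta-balanced
   product distribution Mx is nearly uniform, even after one bit of x is fixed.
   By strong concavity, querying an unqueried slot gains about 4^-k delta, while
   by smoothness querying a bit of x gains exponentially less. Hence fewer than
   2^k queries only ever reach slots, half of the slots remain unqueried at
   every leaf, and the leaf errs with probability Omega(delta).

   The comparison of the gains loses a factor delta, harmless when
   delta > 2^-k; if 2^k <= k / delta, parity on 2^k bits is hard for every tree
   of depth less than 2^k.

   Restricting a function under a product distribution amounts to moving some
   of the marginals to 0 or 1, so everything reduces to the multilinear
   extension [mean p f] of f. *)

(** * Second-order bounds for impurity functions *)

Section SecondOrder.
Variable R : realType.
Local Open Scope classical_set_scope.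

(** Clearing the denominator makes the estimate hold at [s = t] as well, so the punctured
    neighbourhood of the limit becomes a full one. *)
Lemma has_deriv01_near (f : R -> R) (t l e : R) : 0 < e -> has_deriv01 f t l ->
  \forall s \near t, s \in `[0, 1]%R ->
    `|f s - f t - l * (s - t)| <= e * `|s - t|.
Proof.
move=> e0 /cvgrPdist_le /(_ _ e0); rewrite /dnbhs !near_withinE.
apply: filterS => s /= H s01.
have [->|st] := eqVneq s t; first by rewrite !subrr mulr0 subrr normr0 mulr0.
have st0 : s - t != 0 by rewrite subr_eq0.
have -> : f s - f t - l * (s - t) = - ((l - (f s - f t) / (s - t)) * (s - t)).
  by field.
rewrite normrN normrM ler_wpM2r //; exact: H.
Qed.

(** At an interior point the restriction to [0, 1] is invisible. The Caratheodory function is the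
    difference quotient, completed by [l] at [t]. *)
Lemma has_deriv01_is_derive (f : R -> R) (t l : R) :
  t \in `]0, 1[%R -> has_deriv01 f t l -> is_derive t 1 f l.
Proof.
move=> t01 ft; apply/is_derive1_caratheodory.
exists (fun s => if s == t then l else (f s - f t) / (s - t)); split.
- move=> s; case: eqVneq => [->|st]; first by rewrite !subrr mulr0.
  by rewrite divfK // subr_eq0.
- apply/cvgrPdist_le => e e0; rewrite eqxx.
  have H1 := has_deriv01_near e0 ft.
  have H2 : \forall s \near t, s \in `]0, 1[%R by exact: near_in_itvoo.
  near=> s; case: eqVneq => [_|st]; first by rewrite subrr normr0 ltW.
  have st0 : s - t != 0 by rewrite subr_eq0.
  rewrite -(@ler_pM2r _ `|s - t|) ?normr_gt0 // -normrM -normrN.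
  have -> : - ((l - (f s - f t) / (s - t)) * (s - t)) = f s - f t - l * (s - t).
    by field.
  near: s; apply: filterS2 H1 H2 => s + /subset_itv_oo_cc s01; exact.
- by rewrite eqxx.
Unshelve. all: end_near. Qed.

(** The mean value theorem is later applied up to the endpoints 0 and 1, where only one-sided
    derivatives exist. Near [t] the increment of [f] is at most [1 + |f' t|] times that of the
    argument. *)
Lemma has_deriv01_continuous (f f' : R -> R) :
  (forall t : R, t \in `[0, 1]%R -> has_deriv01 f t (f' t)) ->
  {within `[0, 1], continuous f}.
Proof.
move=> ff'; apply/subspace_continuousP => t t01; apply/cvgrPdist_le => e e0.
rewrite near_withinE.
have H := has_deriv01_near ltr01 (ff' t t01).
have K0 : 0 < 1 + `|f' t| by rewrite ltr_pwDl.
have eK : 0 < e / (1 + `|f' t|) by rewrite divr_gt0.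
near=> s => s01.
have sd : `|s - t| <= e / (1 + `|f' t|).
  by rewrite distrC; near: s; move/cvgrPdist_le: (@cvg_id _ (nbhs t)); exact.
have : `|f s - f t - f' t * (s - t)| <= 1 * `|s - t|.
  by move: s01; near: s; exact: H.
move: sd; rewrite ler_pdivlMr // distrC => sd h.
have -> : f t - f s = - ((f s - f t - f' t * (s - t)) + f' t * (s - t)) by ring.
rewrite normrN; apply: le_trans (ler_normD _ _) _; rewrite normrM.
by apply: le_trans sd; move: h; rewrite (distrC s t); lra.
Unshelve. all: end_near. Qed.

Lemma convex01 (f f' f'' : R -> R) (a b p : R) :
  (forall t : R, t \in `]0, 1[%R -> is_derive t 1 f (f' t)) ->
  (forall t : R, t \in `]0, 1[%R -> is_derive t 1 f' (f'' t)) ->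
  {within `[0, 1], continuous f} ->
  (forall t : R, t \in `]0, 1[%R -> 0 <= f'' t) ->
  a \in `[0, 1]%R -> b \in `[0, 1]%R -> p \in `[0, 1]%R ->
  f (p * a + (1 - p) * b) <= p * f a + (1 - p) * f b.
Proof.
move=> ff' ff'' fc f0.
wlog ab : a b p / a <= b.
  move=> H a01 b01 p01; have [ab|/ltW ba] := leP a b; first exact: H.
  have := H b a (1 - p) ba b01 a01.
  rewrite subKr [X in f X]addrC [X in _ <= X]addrC.
  by apply; move: p01; rewrite !in_itv /=; lra.
rewrite !in_itv /= => a01 b01 p01.
have [/eqP ->|ab'] := boolP (a == b).
  by rewrite -!mulrDl [p + _]addrC subrK !mul1r.
have {ab ab'}ab : a < b by rewrite lt_neqAle ab'.
have [->|p0] := eqVneq p 0; first by rewrite !mul0r subr0 !mul1r !add0r.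
have [->|p1] := eqVneq p 1; first by rewrite subrr !mul0r !mul1r !addr0.
have {p0 p1 p01} [p0 p1] : 0 < p /\ p < 1.
  by rewrite !lt_neqAle p1 eq_sym p0; case/andP: p01.
set q := p * a + _.
have aq : a < q.
  rewrite -subr_gt0; have -> : q - a = (1 - p) * (b - a) by rewrite /q; ring.
  by apply: mulr_gt0; lra.
have qb : q < b.
  rewrite -subr_gt0; have -> : b - q = p * (b - a) by rewrite /q; ring.
  by apply: mulr_gt0; lra.
have mvt (x y : R) : 0 <= x -> x < y -> y <= 1 ->
    exists2 c : R, c \in `]x, y[%R & f y - f x = f' c * (y - x).
  move=> x0 xy y1.
  have df c : c \in `]x, y[%R -> is_derive c 1 f (f' c).
    by rewrite in_itv /= => /andP[xc cy]; apply: ff'; rewrite in_itv /=; lra.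
  have cf : {within `[x, y], continuous f}.
    by apply: continuous_subspaceW fc; apply: subset_itv; rewrite bnd_simp.
  exact: MVT xy df cf.
have [c1 c1q e1] : exists2 c : R, c \in `]a, q[%R & f q - f a = f' c * (q - a).
  by apply: mvt => //; lra.
have [c2 c2q e2] : exists2 c : R, c \in `]q, b[%R & f b - f q = f' c * (b - q).
  by apply: mvt => //; lra.
move: c1q c2q; rewrite !in_itv /= => c1q c2q.
have [c c12 e3] : exists2 c : R, c \in `[c1, c2]%R & f' c2 - f' c1 = f'' c * (c2 - c1).
  have le12 : c1 <= c2 by lra.
  have c01 c : c \in `[c1, c2]%R -> c \in `]0, 1[%R by rewrite !in_itv /=; lra.
  have df c : c \in `]c1, c2[%R -> is_derive c 1 f' (f'' c).
    by move=> /subset_itv_oo_cc /c01 /ff''.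
  have cf : {within `[c1, c2], continuous f'}.
    apply: derivable_within_continuous => c /c01 /ff'' dc; exact: ex_derive.
  exact: MVT_segment le12 df cf.
have : 0 <= f'' c * (c2 - c1).
  apply: mulr_ge0; last by lra.
  by apply: f0; move: c12; rewrite !in_itv /=; lra.
rewrite -e3 => h.
(* Since [q - a = (1 - p) * (b - a)] and [b - q = p * (b - a)], this weight turns both slopes into
   increments of [f], and the inequality becomes the convexity claim. *)
have : 0 <= p * (1 - p) * (b - a) * (f' c2 - f' c1).
  by apply: mulr_ge0 => //; apply: mulr_ge0; [apply: mulr_ge0|]; lra.
have -> : p * (1 - p) * (b - a) * (f' c2 - f' c1) =
  p * (1 - p) * (b - a) * f' c2 - p * (1 - p) * (b - a) * f' c1 by ring.
have -> : p * (1 - p) * (b - a) * f' c2 = (1 - p) * (f b - f q).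
  by rewrite e2 /q; ring.
have -> : p * (1 - p) * (b - a) * f' c1 = p * (f q - f a) by rewrite e1 /q; ring.
lra.
Qed.

(** Both [- G t - alpha / 2 * t ^+ 2] and [G t + L / 2 * t ^+ 2] are convex on [0, 1], and the
    convexity gap of [t ^+ 2] itself is exactly [p * (1 - p) * (a - b) ^+ 2]. The middle term is the
    purity gain of a variable of marginal [p] whose two restrictions have means [a] and [b]. *)
Lemma smooth_impurity_gain (alpha L : R) (G : R -> R) (a b p : R) :
  smooth_impurity alpha L G ->
  a \in `[0, 1]%R -> b \in `[0, 1]%R -> p \in `[0, 1]%R ->
  alpha / 2 * (p * (1 - p) * (a - b) ^+ 2)
    <= G (p * a + (1 - p) * b) - p * G a - (1 - p) * G b
    <= L / 2 * (p * (1 - p) * (a - b) ^+ 2).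
Proof.
move=> [_ [G' [G'' GG]]] a01 b01 p01.
have oc (t : R) : t \in `]0, 1[%R -> t \in `[0, 1]%R by exact: subset_itv_oo_cc.
have dG (t : R) : t \in `]0, 1[%R -> is_derive t 1 G (G' t).
  by move=> t01; have [/has_deriv01_is_derive H _ _] := GG t (oc _ t01); exact: H.
have dG' (t : R) : t \in `]0, 1[%R -> is_derive t 1 G' (G'' t).
  by move=> t01; have [_ /has_deriv01_is_derive H _] := GG t (oc _ t01); exact: H.
have cG : {within `[0, 1], continuous G}.
  by apply: (@has_deriv01_continuous _ G') => t /GG[].
have sq c : {within `[0, 1], continuous (fun t : R => c * t ^+ 2)}.
  apply: continuous_subspaceT => t.
  by apply: cvgM; [exact: cvg_cst|exact: exprn_continuous].
have key s c : (forall t : R, t \in `[0, 1]%R -> 0 <= s * G'' t + 2 * c) ->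
    s * (G (p * a + (1 - p) * b) - p * G a - (1 - p) * G b)
      <= c * (p * (1 - p) * (a - b) ^+ 2).
  move=> sc.
  suff : s * G (p * a + (1 - p) * b) + c * (p * a + (1 - p) * b) ^+ 2
      <= p * (s * G a + c * a ^+ 2) + (1 - p) * (s * G b + c * b ^+ 2).
    by rewrite -subr_ge0 => H; rewrite -subr_ge0; apply: le_trans H _; lra.
  apply: (@convex01 (fun t => s * G t + c * t ^+ 2)
    (fun t => s * G' t + 2 * c * t) (fun t => s * G'' t + 2 * c)) => //.
  - move=> t /dG ?; apply: is_derive_eq.
    rewrite /GRing.scale /=; ring.
  - move=> t /dG' ?; apply: is_derive_eq.
    rewrite /GRing.scale /=; ring.
  - move=> t; apply: cvgD; last exact: sq.
    by apply: cvgM; [exact: cvg_cst|exact: cG].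
  - by move=> t /oc /sc.
have GG2 (t : R) : t \in `[0, 1]%R -> - L <= G'' t <= - alpha by move=> /GG[].
apply/andP; split.
- have := key (-1) (- (alpha / 2)) _; set u := G _ - _ - _; set v := _ * _ ^+ 2.
  suff H : forall t : R, t \in `[0, 1]%R -> 0 <= -1 * G'' t + 2 * - (alpha / 2).
    by move/(_ H); lra.
  by move=> t /GG2; lra.
- have := key 1 (L / 2) _; set u := G _ - _ - _; set v := _ * _ ^+ 2.
  suff H : forall t : R, t \in `[0, 1]%R -> 0 <= 1 * G'' t + 2 * (L / 2).
    by move/(_ H); lra.
  by move=> t /GG2; lra.
Qed.

End SecondOrder.

(** * Multilinear extension and restrictions *)

Section ProductMean.
Variables (R : realType) (n : nat).
Implicit Types (p : 'I_n -> R) (g : cube n -> R) (x : cube n).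

Definition pweight p x : R := \prod_i (if x i then p i else 1 - p i).

Definition mean p g : R := \sum_x pweight p x * g x.

Definition upd p (i : 'I_n) (b : bool) : 'I_n -> R :=
  fun j => if j == i then b%:R else p j.

(** The right fold makes the earliest constraint on an index win, as in [overwrite]. *)
Definition restrict_prob (pi : restriction n) p : 'I_n -> R :=
  foldr (fun c q => upd q c.1 c.2) p pi.

Lemma eq_mean p q g h : p =1 q -> g =1 h -> mean p g = mean q h.
Proof.
move=> pq gh; apply: eq_bigr => x _; rewrite gh; congr (_ * _).
by apply: eq_bigr => i _; rewrite pq.
Qed.

(** Independence of the coordinates. Every explicit mean below is obtained by first writing the
    function as a combination of such products. *)
Lemma mean_prod p (h : 'I_n -> bool -> R) :
  mean p (fun x => \prod_i h i (x i)) =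
  \prod_i (p i * h i true + (1 - p i) * h i false).
Proof.
rewrite /mean (eq_bigr (fun x : cube n =>
  \prod_i ((if x i then p i else 1 - p i) * h i (x i)))); last first.
  by move=> x _; rewrite big_split.
rewrite -(bigA_distr_bigA (fun i b => (if b then p i else 1 - p i) * h i b)).
by apply: eq_bigr => i _; rewrite big_bool.
Qed.

Lemma sum_pweight p : \sum_x pweight p x = 1.
Proof.
rewrite -(bigA_distr_bigA (fun i (b : bool) => if b then p i else 1 - p i)).
by rewrite big1 // => i _; rewrite big_bool /=; ring.
Qed.

Lemma pweight_ge0 p x : (forall i, 0 <= p i <= 1) -> 0 <= pweight p x.
Proof.
by move=> p01; apply: prodr_ge0 => i _; case: ifP; have := p01 i; lra.
Qed.

Lemma mean_cst p (a : R) : mean p (fun=> a) = a.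
Proof. by rewrite /mean -mulr_suml sum_pweight mul1r. Qed.

Lemma mean_sum p (I : finType) (F : I -> cube n -> R) :
  mean p (fun x => \sum_j F j x) = \sum_j mean p (F j).
Proof.
rewrite exchange_big /=; apply: eq_bigr => x _.
by rewrite mulr_sumr.
Qed.

Lemma meanZ p (a : R) g : mean p (fun x => a * g x) = a * mean p g.
Proof. by rewrite mulr_sumr; apply: eq_bigr => x _; rewrite mulrCA. Qed.

Lemma meanD p g h : mean p (fun x => g x + h x) = mean p g + mean p h.
Proof. by rewrite -big_split; apply: eq_bigr => x _; rewrite mulrDr. Qed.

Lemma mean_compl p (f : cube n -> bool) :
  mean p (fun x => (~~ f x)%:R) = 1 - mean p (fun x => (f x)%:R).
Proof.
rewrite -[X in X - _](mean_cst p) -sumrB; apply: eq_bigr => x _.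
by case: (f x) => /=; ring.
Qed.

Lemma mean01 p (f : cube n -> bool) : (forall i, 0 <= p i <= 1) ->
  0 <= mean p (fun x => (f x)%:R) <= 1.
Proof.
move=> p01; have H (g : cube n -> bool) : 0 <= mean p (fun x => (g x)%:R).
  by apply: sumr_ge0 => x _; rewrite mulr_ge0 // pweight_ge0.
have := H f; have := H (fun x => ~~ f x); rewrite mean_compl; lra.
Qed.

Lemma mean_overwrite_bit p g (i : 'I_n) b :
  mean p (fun x => g (overwrite_bit x i b)) = mean (upd p i b) g.
Proof.
have -> : mean p (fun x => g (overwrite_bit x i b)) =
    mean p (fun x => \sum_y g y * (overwrite_bit x i b == y)%:R).
  apply: eq_mean => // x; rewrite (bigD1 (overwrite_bit x i b)) //= eqxx mulr1.
  by rewrite big1 ?addr0 // => y; rewrite eq_sym => /negPf ->; rewrite mulr0.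
rewrite mean_sum; apply: eq_bigr => y _; rewrite meanZ mulrC; congr (_ * _).
(* The event that the overwritten point equals [y] is a conjunction over coordinates, so its
   indicator is a product. *)
pose h j c : R := ((if j == i then b else c) == y j)%:R.
transitivity (mean p (fun x => \prod_j h j (x j))).
  apply: eq_mean => // x; have [E|/eqP neq] := eqVneq (overwrite_bit x i b) y.
    by rewrite big1 // => j _; rewrite /h -E ffunE eqxx.
  have [j jx|H] := pickP (fun j => overwrite_bit x i b j != y j).
    rewrite (bigD1 j) //= /h.
    by move: jx; rewrite ffunE => /negPf ->; rewrite mul0r.
  by case: neq; apply/ffunP => j; apply/eqP; apply: negbFE (H j).
rewrite mean_prod; apply: eq_bigr => j _; rewrite /h /upd.
by case: (j == i); case: (y j); case: (b) => /=; ring.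
Qed.

Lemma mean_overwrite p (pi : restriction n) g :
  mean p (fun x => g (overwrite pi x)) = mean (restrict_prob pi p) g.
Proof.
elim: pi g => [|c pi IH] g //=.
by rewrite (IH (fun y => g (overwrite_bit y c.1 c.2))) mean_overwrite_bit.
Qed.

Lemma mean_split p g (i : 'I_n) :
  mean p g = p i * mean (upd p i true) g + (1 - p i) * mean (upd p i false) g.
Proof.
rewrite !mulr_sumr -big_split; apply: eq_bigr => x _.
rewrite /pweight /= !(bigD1 i (P := xpredT)) //= /upd eqxx !mulrA -!mulrDl.
set A := \prod_(_ | _) _; set B := \prod_(_ | _) _; set C := \prod_(_ | _) _.
have -> : B = A by apply: eq_bigr => j /negPf ->.
have -> : C = A by apply: eq_bigr => j /negPf ->.
by case: (x i) => /=; ring.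
Qed.

Lemma restrict_prob_notin p pi (i : 'I_n) :
  i \notin map fst pi -> restrict_prob pi p i = p i.
Proof.
elim: pi => //= c pi IH; rewrite inE negb_or => /andP[/negPf ic /IH <-].
by rewrite /upd ic.
Qed.

Lemma restrict_prob_in p pi (i : 'I_n) : i \in map fst pi ->
  exists b : bool, restrict_prob pi p i = b%:R.
Proof.
elim: pi => //= c pi IH; rewrite inE /upd; case: eqP => [_ _|_ /= /IH //].
by exists c.2.
Qed.

(** A constraint added below [pi] is shadowed when [pi] already fixes [i]; otherwise it commutes
    with [pi]. *)
Lemma restrict_prob_upd p pi (i : 'I_n) b j :
  restrict_prob pi (upd p i b) j =
  if i \in map fst pi then restrict_prob pi p j else upd (restrict_prob pi p) i b j.
Proof.
elim: pi => [//|c pi IH] /=; rewrite inE /upd.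
have [->|jc] := eqVneq j c.1.
  by case: (eqVneq i c.1) => //= _; case: ifP.
rewrite [LHS]IH; have [ic|ic] /= := eqVneq i c.1; last by [].
by case: ifP => // _; rewrite /upd ic (negPf jc).
Qed.

Lemma restrict_prob_rcons p pi (i : 'I_n) b :
  restrict_prob (rcons pi (i, b)) p = restrict_prob pi (upd p i b).
Proof. by rewrite /restrict_prob foldr_rcons. Qed.

Lemma restrict_prob01 p pi : (forall i, 0 <= p i <= 1) ->
  forall i, 0 <= restrict_prob pi p i <= 1.
Proof.
move=> p01; elim: pi => //= c pi IH i; rewrite /upd; case: ifP => // _.
by case: c.2 => /=; lra.
Qed.

End ProductMean.

(** * Product distributions expressed through their marginals *)

Section ProductDist.
Variables (R : realType) (n : nat) (D : dist R n).
Hypothesis Dprod : product_dist D.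

Definition marginal (i : 'I_n) : R := prob D (fun x => x i).

Lemma pmf_pweight x : D x = pweight marginal x.
Proof.
rewrite Dprod; apply: eq_bigr => i _; rewrite /marginal /prob.
case: (x i); first by apply: eq_bigl => y; rewrite eqb_id.
apply/eqP; rewrite eq_sym subr_eq -(pmf_sum1 D); apply/eqP.
rewrite (bigID (fun y : cube n => y i)) addrC /=; congr (_ + _).
by apply: eq_bigl => y; case: (y i).
Qed.

Lemma prob_mean (A : pred (cube n)) :
  prob D A = mean marginal (fun x => (A x)%:R).
Proof.
rewrite /prob big_mkcond; apply: eq_bigr => x _; rewrite pmf_pweight.
by case: (A x); rewrite ?mulr1 ?mulr0.
Qed.

Lemma expect_mean (g : cube n -> bool) :
  expect D g = mean marginal (fun x => (g x)%:R).
Proof. by apply: eq_bigr => x _; rewrite pmf_pweight. Qed.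

Lemma marginalE i : expect D (fun x => x i) = marginal i.
Proof. by rewrite expect_mean /marginal prob_mean. Qed.

Lemma expect_restrict (f : cube n -> bool) pi :
  expect D (restrict_fun f pi) =
  mean (restrict_prob pi marginal) (fun x => (f x)%:R).
Proof. by rewrite expect_mean (mean_overwrite _ _ (fun x => (f x)%:R)). Qed.

Lemma expect_restrict_bit (f : cube n -> bool) pi (i : 'I_n) b :
  i \notin map fst pi ->
  expect D (restrict_fun (restrict_fun f pi) [:: (i, b)]) =
  mean (upd (restrict_prob pi marginal) i b) (fun x => (f x)%:R).
Proof.
move=> ipi; rewrite expect_mean.
rewrite (mean_overwrite_bit _ (fun x => (f (overwrite pi x))%:R)).
rewrite (mean_overwrite _ _ (fun x => (f x)%:R)); apply: eq_mean => // j.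
by rewrite restrict_prob_upd (negPf ipi).
Qed.

(** For an unqueried variable, the weight in the purity gain, taken from [D] itself, agrees with the
    marginal after restriction. The gain then has the form bounded by [smooth_impurity_gain]. *)
Lemma purity_gain_restrict (G : R -> R) (f : cube n -> bool) pi (i : 'I_n) :
  i \notin map fst pi ->
  let p := marginal i in
  let a b := mean (upd (restrict_prob pi marginal) i b) (fun x => (f x)%:R) in
  purity_gain G D (restrict_fun f pi) i =
  G (p * a true + (1 - p) * a false) - p * G (a true) - (1 - p) * G (a false).
Proof.
move=> ipi p a; rewrite /purity_gain !expect_restrict_bit // expect_restrict.
by rewrite (mean_split _ _ i) restrict_prob_notin.
Qed.

End ProductDist.

(** * Lower bounds on tree errors, and construction of trees *)

Section Trees.
Variables (R : realType) (n : nat).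

Lemma mean_upd_node (q : 'I_n -> R) (f : cube n -> bool) i b T0 T1 :
  mean (upd q i b) (fun x => (tree_eval (Node i T0 T1) x != f x)%:R) =
  mean (upd q i b) (fun x => (tree_eval (if b then T1 else T0) x != f x)%:R).
Proof.
rewrite -(mean_overwrite_bit q (fun x => (tree_eval (Node i T0 T1) x != f x)%:R)).
rewrite -(mean_overwrite_bit q (fun x =>
  (tree_eval (if b then T1 else T0) x != f x)%:R)).
by apply: eq_mean => // x; rewrite /= ffunE eqxx; case: b.
Qed.

(* The bound holds at every leaf, and the error of a tree is a convex
   combination of the errors at its leaves. *)
Lemma mean_tree_error_ge (p : 'I_n -> R) (f : cube n -> bool) (Q : pred 'I_n)
    (N : nat) (c : R) (T : dtree n) (pi : restriction n) :
  (forall i, 0 <= p i <= 1) ->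
  (forall pi', all (Q \o fst) pi' -> (size pi' < N)%N ->
     c <= mean (restrict_prob pi' p) (fun x => (f x)%:R) <= 1 - c) ->
  (forall pi' i, (pi', i) \in internal_nodes pi T ->
     all (Q \o fst) pi' -> (size pi' < N)%N -> Q i) ->
  all (Q \o fst) pi -> (size pi + tree_depth T < N)%N ->
  c <= mean (restrict_prob pi p) (fun x => (tree_eval T x != f x)%:R).
Proof.
(* [Q] propagates down the tree: the hypothesis on nodes yields [Q] for a query once all queries
   above it satisfy [Q]. *)
move=> p01 leaf; elim: T pi => [b|i T0 IH0 T1 IH1] pi nodes piQ dN.
  have := leaf pi piQ; rewrite addn0 in dN => /(_ dN).
  case: b {nodes} => /andP[lf0 lf1].
    rewrite (eq_mean (q := restrict_prob pi p) (h := fun x => (~~ f x)%:R)) //.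
    by rewrite mean_compl; lra.
  rewrite (eq_mean (q := restrict_prob pi p) (h := fun x => (f x)%:R)) // => x.
  by rewrite /=; case: (f x).
have piN : (size pi < N)%N by move: dN => /=; lia.
have Qi : Q i by apply: (nodes pi) => //; rewrite inE eqxx.
have child b : c <= mean (restrict_prob (rcons pi (i, b)) p)
    (fun x => (tree_eval (if b then T1 else T0) x != f x)%:R).
  have rQ : all (Q \o fst) (rcons pi (i, b)) by rewrite all_rcons /= Qi.
  case: b rQ => rQ; [apply: IH1 => // | apply: IH0 => //].
  - by move=> pi' j H; apply: nodes; rewrite inE mem_cat H !orbT.
  - by rewrite size_rcons; move: dN => /=; lia.
  - by move=> pi' j H; apply: nodes; rewrite inE mem_cat H !orbT.
  - by rewrite size_rcons; move: dN => /=; lia.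
set q := restrict_prob pi p.
rewrite (mean_split q _ i) !mean_upd_node /=.
(* A repeated query has a determined answer [b]: one child carries all the weight, and its new
   constraint is shadowed by [pi]. *)
have [ipi|ipi] := boolP (i \in map fst pi).
  have [b qb] := restrict_prob_in p ipi.
  have {}child : c <= mean (upd q i b)
      (fun x => (tree_eval (if b then T1 else T0) x != f x)%:R).
    rewrite (eq_mean (q := restrict_prob (rcons pi (i, b)) p) (h := fun x =>
      (tree_eval (if b then T1 else T0) x != f x)%:R)) // => j.
    rewrite restrict_prob_rcons restrict_prob_upd ipi /upd.
    by case: eqP => // ->; rewrite qb.
  rewrite /q qb; case: b child {qb} => /=; rewrite -/q => child; lra.
have {}child b : c <= mean (upd q i b)
    (fun x => (tree_eval (if b then T1 else T0) x != f x)%:R).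
  rewrite (eq_mean (q := restrict_prob (rcons pi (i, b)) p) (h := fun x =>
    (tree_eval (if b then T1 else T0) x != f x)%:R)) // => j.
  by rewrite restrict_prob_rcons restrict_prob_upd (negPf ipi).
have := child true; have := child false; have := restrict_prob01 pi p01 i.
rewrite -/q /=; set A := mean _ _; set B := mean _ _; nra.
Qed.

(** Query all of [s], then continue with the tree chosen by the answers. Each query replaces [F] by
    its restriction, which depends on one variable fewer. *)
Lemma tree_of_queries (s : seq 'I_n) (F : cube n -> dtree n) (d : nat) :
  (forall x y : cube n, {in s, x =1 y} -> F x = F y) ->
  (forall x, tree_depth (F x) <= d)%N ->
  exists T : dtree n, (forall x, tree_eval T x = tree_eval (F x) x) /\
    (tree_depth T <= size s + d)%N.
Proof.
elim: s F => [|i s IH] F Fs Fd.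
  exists (F [ffun=> false]); split=> // x.
  by congr tree_eval; apply: Fs.
have {}IH b : exists T : dtree n,
    (forall x, tree_eval T x = tree_eval (F (overwrite_bit x i b)) x) /\
    (tree_depth T <= size s + d)%N.
  apply: (IH (fun x => F (overwrite_bit x i b))) => // x y xy.
  apply: Fs => j; rewrite inE !ffunE.
  by case: eqP => //= _; exact: xy.
have [T0 [T0e T0d]] := IH false; have [T1 [T1e T1d]] := IH true.
exists (Node i T0 T1); split=> [x /=|/=]; last by lia.
have Fx b : x i = b -> F (overwrite_bit x i b) = F x.
  by move=> xb; apply: Fs => j _; rewrite ffunE; case: eqP => // ->.
by case: ifP => xi; rewrite ?T0e ?T1e Fx.
Qed.

End Trees.

(** * Addresses given by a linear code *)

Section Characters.
Variables (R : realType) (d : nat).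
Implicit Types S v w : cube d.

Definition dot S v : bool := \big[addb/false]_(l < d) (S l && v l).

Lemma dotC S v : dot S v = dot v S.
Proof. by apply: eq_bigr => l _; rewrite andbC. Qed.

Lemma sign_big_addb (I : finType) (F : I -> bool) :
  (-1) ^+ (\big[addb/false]_i F i) = \prod_i (-1) ^+ F i :> R.
Proof. exact: (big_morph (fun b : bool => (-1) ^+ b) (@signr_addb R)). Qed.

(** Orthogonality of the characters of F_2^d: the sum over [S] factors over coordinates, and a
    coordinate where [v] and [w] differ contributes 0. *)
Lemma sum_sign_dot v w :
  \sum_S (-1) ^+ dot S v * (-1) ^+ dot S w = 2 ^+ d * (v == w)%:R :> R.
Proof.
rewrite (eq_bigr (fun S : cube d =>
  \prod_l ((-1) ^+ (S l && v l) * (-1) ^+ (S l && w l)))); last first.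
  by move=> S _; rewrite !sign_big_addb big_split.
rewrite -(bigA_distr_bigA (fun l b => (-1) ^+ (b && v l) * (-1) ^+ (b && w l) : R)).
rewrite (eq_bigr (fun l => 2 * (v l == w l)%:R)); last first.
  by move=> l _; rewrite big_bool /=; case: (v l); case: (w l) => /=; ring.
rewrite big_split /= prodr_const card_ord; congr (_ * _).
have [->|/eqP vw] := eqVneq v w; first by rewrite big1 // => l _; rewrite eqxx.
have [l vwl|H] := pickP (fun l => v l != w l).
  by rewrite (bigD1 l) //= (negPf vwl) mul0r.
by case: vw; apply/ffunP => l; apply/eqP; apply: negbFE (H l).
Qed.

Lemma dot0 v : dot v [ffun=> false] = false.
Proof. by rewrite /dot big1 // => l _; rewrite ffunE andbF. Qed.

Lemma sum_sign_dot0 S : \sum_v (-1) ^+ dot S v = 2 ^+ d * (S == [ffun=> false])%:R :> R.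
Proof.
rewrite -sum_sign_dot; apply: eq_bigr => v _.
by rewrite dot0 expr0 mulr1 dotC.
Qed.

(** Each term is [r] to the Hamming weight of the word with letters [dot S (c i)]. It bounds the
    character [S] of the address when every address input has bias [|1 - 2 * p i| <= r]. *)
Definition code_bias (m : nat) (c : 'I_m -> cube d) (r : R) : R :=
  \sum_(S : cube d | S != [ffun=> false]) \prod_i (if dot S (c i) then r else 1).

(* The average of the left-hand side over all codes is at most the right-hand
   side, since a character [S != 0] is balanced on [cube d]. *)
Lemma exists_code (m : nat) (r : R) : 0 <= r ->
  exists c : 'I_m -> cube d, code_bias c r <= 2 ^+ d * ((1 + r) / 2) ^+ m.
Proof.
move=> r0; set B := _ * _ ^+ m.
have [c Hc|H] := pickP (fun c : {ffun 'I_m -> cube d} => code_bias c r <= B).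
  by exists c.
have : \sum_(c : {ffun 'I_m -> cube d}) B <
    \sum_(c : {ffun 'I_m -> cube d}) code_bias c r.
  apply: ltr_sum; last by move=> c _; rewrite ltNge H.
  by apply/hasP; exists [ffun=> [ffun=> false]]; rewrite ?mem_index_enum.
rewrite /code_bias exchange_big /=.
rewrite [X in _ < X](eq_bigr (fun=> (2 ^+ d * ((1 + r) / 2)) ^+ m)); last first.
  move=> S S0.
  rewrite -(bigA_distr_bigA (fun (i : 'I_m) v => if dot S v then r else 1)).
  rewrite prodr_const card_ord; congr (_ ^+ _).
  (* Splitting off the character leaves the average [(1 + r) / 2], because a nonzero [S] sums to
     0. *)
  rewrite (eq_bigr (fun v => (1 + r) / 2 + (1 - r) / 2 * (-1) ^+ dot S v)).
    rewrite big_split /= sumr_const -mulr_sumr sum_sign_dot0 (negPf S0) !mulr0.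
    by rewrite addr0 card_ffun card_bool card_ord -[LHS]mulr_natl natrX.
  by move=> v _; case: (dot S v) => /=; field.
rewrite !sumr_const !card_ffun !card_bool !card_ord => lt; exfalso.
move: lt; apply/negP; rewrite -leNgt /B exprMn.
rewrite -[X in X <= _]mulr_natl -[X in _ <= X]mulr_natl natrX natrX.
rewrite mulrCA; apply: ler_wpM2l; first by rewrite !exprn_ge0.
apply: ler_wpM2r; first by rewrite exprn_ge0 //; lra.
rewrite -natrX ler_nat; apply: leq_trans (max_card _) _.
by rewrite card_ffun card_bool card_ord.
Qed.

End Characters.

(** * The selector function and the distribution of its address *)

Section Selector.
Variables (R : realType) (d m : nat) (code : 'I_m -> cube d).
Local Notation n := (m + #|cube d|)%N.
Implicit Types (q : 'I_n -> R) (j S : cube d) (x : cube n) (i : 'I_m).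

(** The linear map over F_2 with columns [code i], applied to the first [m] bits. *)
Definition address x : cube d :=
  [ffun l => \big[addb/false]_i (x (lshift _ i) && code i l)].

Definition slot j : 'I_n := rshift m (enum_rank j).

Definition selector x : bool := x (slot (address x)).

(** Fourier inversion for the probability that the address is [j]: the product over [i] is the mean
    of the character [S] of the address. *)
Definition address_prob q j : R := (2 ^+ d)^-1 *
  \sum_S (-1) ^+ dot S j *
    \prod_i (q (lshift _ i) * (-1) ^+ dot S (code i) + (1 - q (lshift _ i))).

Lemma dot_address S x :
  dot S (address x) = \big[addb/false]_i (x (lshift _ i) && dot S (code i)).
Proof.
rewrite /dot (eq_bigr (fun l =>
  \big[addb/false]_i (S l && (x (lshift _ i) && code i l)))); last first.
  by move=> l _; rewrite ffunE big_distrr.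
rewrite exchange_big; apply: eq_bigr => i _; rewrite big_distrr.
by apply: eq_bigr => l _ /=; rewrite andbCA.
Qed.

(** The indicator of [j == address x] is expanded in characters. Address inputs and slots are
    disjoint coordinates, so each term is a product to which [mean_prod] applies. *)
Lemma mean_selector q :
  mean q (fun x => (selector x)%:R) = \sum_j q (slot j) * address_prob q j.
Proof.
(* An address input contributes its sign, slot [j] its value, and every other slot 1. *)
pose h S j (t : 'I_n) (b : bool) : R := match fintype.split t with
  | inl i => (-1) ^+ (b && dot S (code i))
  | inr t => if t == enum_rank j then b%:R else 1 end.
have hE S j x : (-1) ^+ dot S (address x) * (x (slot j))%:R =
    \prod_t h S j t (x t).
  rewrite big_split_ord /= dot_address sign_big_addb; congr (_ * _).
    by apply: eq_bigr => i _; rewrite /h (unsplitK (inl _ i)).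
  rewrite (bigD1 (enum_rank j)) //= /h (unsplitK (inr _ (enum_rank j))) eqxx.
  rewrite big1 ?mulr1 // => t /negPf tj.
  by rewrite (unsplitK (inr _ t)) tj.
transitivity (mean q (fun x => \sum_j \sum_S
    ((2 ^+ d)^-1 * (-1) ^+ dot S j) * \prod_t h S j t (x t))).
  apply: eq_mean => // x.
  have E j : \sum_S ((2 ^+ d)^-1 * (-1) ^+ dot S j) * \prod_t h S j t (x t) =
      (j == address x)%:R * (x (slot j))%:R.
    rewrite (eq_bigr (fun S => ((2 ^+ d)^-1 * (x (slot j))%:R) *
      ((-1) ^+ dot S j * (-1) ^+ dot S (address x)))); last first.
      by move=> S _; rewrite -hE [X in _ * X]mulrC mulrACA.
    have d0 : 2 ^+ d != 0 :> R by rewrite expf_neq0 // pnatr_eq0.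
    by rewrite -mulr_sumr sum_sign_dot mulrACA mulVf // mul1r mulrC.
  rewrite (bigD1 (address x)) //= E eqxx mul1r big1 ?addr0 // => j /negPf jx.
  by rewrite E jx mul0r.
rewrite mean_sum; apply: eq_bigr => j _; rewrite mean_sum /address_prob.
rewrite mulrCA !mulr_sumr; apply: eq_bigr => S _.
rewrite meanZ mean_prod big_split_ord /= -mulrA; congr (_ * _).
rewrite [RHS]mulrC -mulrA; congr (_ * _); congr (_ * _).
  by apply: eq_bigr => i _; rewrite /h (unsplitK (inl _ i)) /= expr0 mulr1.
rewrite (bigD1 (enum_rank j)) //= /h (unsplitK (inr _ (enum_rank j))) eqxx.
rewrite big1 /= => [|t /negPf tj]; first by rewrite /slot; ring.
by rewrite (unsplitK (inr _ t)) tj; ring.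
Qed.

Lemma address_prob_sum q : \sum_j address_prob q j = 1.
Proof.
rewrite -mulr_sumr exchange_big /=.
rewrite (bigD1 [ffun=> false]) //= [X in _ + X]big1 => [|S S0]; last first.
  by rewrite -mulr_suml sum_sign_dot0 (negPf S0) mulr0 mul0r.
rewrite -mulr_suml sum_sign_dot0 eqxx addr0 mulr1 mulrA mulVf.
  by rewrite mul1r big1 // => i _; rewrite dotC dot0; ring.
by rewrite expf_neq0 // pnatr_eq0.
Qed.

Lemma address_prob_upd_slot q j j' b :
  address_prob (upd q (slot j) b) j' = address_prob q j'.
Proof.
congr (_ * _); apply: eq_bigr => S _; congr (_ * _); apply: eq_bigr => i _.
by rewrite /upd eq_lrshift.
Qed.

(** * Near-uniformity of the address, influences and balance *)

Section Mixing.
Variables (r eta : R).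
Hypothesis r_half : 2^-1 <= r <= 1.
Hypothesis code_eta : code_bias code r <= eta.

(* One exceptional coordinate costs a factor [2 >= r^-1]. *)
Lemma address_prob_near q (i0 : 'I_m) j :
  (forall t, 0 <= q t <= 1) ->
  (forall i, i != i0 -> `|1 - 2 * q (lshift _ i)| <= r) ->
  `|2 ^+ d * address_prob q j - 1| <= 2 * eta.
Proof.
move=> q01 qr.
rewrite /address_prob mulrA mulfV ?mul1r ?expf_neq0 ?pnatr_eq0 //.
rewrite (bigD1 [ffun=> false]) //= dotC dot0 expr0 mul1r.
rewrite big1 => [|i _]; last by rewrite dotC dot0; ring.
rewrite [1 + _]addrC addrK; apply: le_trans (ler_norm_sum _ _ _) _.
apply: le_trans (ler_wpM2l _ code_eta) => //; rewrite mulr_sumr.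
apply: ler_sum => S _; rewrite normrM normrX normrN1 expr1n mul1r normr_prod.
(* Placing the 2 at [i0] permits a comparison factor by factor; there the left side is at most 1,
   which is at most [2 * r]. *)
have -> : 2 = \prod_(i < m) (if i == i0 then 2 else 1) :> R.
  by rewrite -big_mkcond big_pred1_eq.
rewrite -big_split /=; apply: ler_prod => i _; rewrite normr_ge0 /=.
have := q01 (lshift _ i); set t := q _ => t01.
case: (dot S (code i)) => /=; last first.
  by rewrite expr0 mulr1 addrC subrK normr1 mulr1; case: ifP => _; rewrite ?ler1n.
rewrite (_ : t * _ + (1 - t) = 1 - 2 * t); last by rewrite expr1; ring.
case: eqP => [_|/eqP ii0]; last by rewrite mul1r qr.
by rewrite ler_norml; case/andP: t01 => t0 t1; case/andP: r_half => r0 r1; lra.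
Qed.

(** The address stays nearly uniform whichever value is given to input [i], so each of the [2 ^ d]
    address probabilities moves by at most [4 * eta / 2 ^+ d]. *)
Lemma influence_address q i :
  (forall t, 0 <= q t <= 1) ->
  (forall i, `|1 - 2 * q (lshift _ i)| <= r) ->
  `|mean (upd q (lshift _ i) true) (fun x => (selector x)%:R) -
    mean (upd q (lshift _ i) false) (fun x => (selector x)%:R)| <= 4 * eta.
Proof.
move=> q01 qr; rewrite !mean_selector -sumrB.
have near b j : `|2 ^+ d * address_prob (upd q (lshift _ i) b) j - 1| <= 2 * eta.
  apply: (address_prob_near (i0 := i)) => [t|k ki].
    by rewrite /upd; case: ifP => // _; case: b => /=; lra.
  by rewrite /upd (inj_eq (@lshift_inj _ _)) (negPf ki).
apply: le_trans (ler_norm_sum _ _ _) _.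
have -> : 4 * eta = \sum_(j : cube d) (2 ^+ d)^-1 * (4 * eta).
  rewrite sumr_const card_ffun card_bool card_ord -[RHS]mulr_natl natrX.
  by rewrite mulrA mulfV ?mul1r // expf_neq0 // pnatr_eq0.
apply: ler_sum => j _; rewrite /upd !eq_rlshift -mulrBr normrM.
have d0 : 0 < 2 ^+ d :> R by rewrite exprn_gt0.
rewrite -(@ler_pM2l _ (2 ^+ d)) // mulrCA mulrA [X in _ <= X]mulrA.
rewrite mulfV ?gt_eqF // mul1r.
have := near true j; have := near false j; rewrite /upd.
set A := address_prob _ j; set B := address_prob _ j => HA HB.
have -> : `|q (slot j)| * 2 ^+ d * `|B - A| =
    `|q (slot j)| * `|(2 ^+ d * B - 1) - (2 ^+ d * A - 1)|.
  rewrite (_ : 2 ^+ d * B - 1 - _ = 2 ^+ d * (B - A)); last by ring.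
  by rewrite [in RHS]normrM (gtr0_norm d0) mulrA.
have -> : 4 * eta = 1 * (2 * eta + 2 * eta) by ring.
apply: ler_pM => //; first by have := q01 (slot j); rewrite ler_norml; lra.
by apply: le_trans (ler_normB _ _) _; apply: lerD.
Qed.

Hypothesis m_gt0 : (0 < m)%N.

Lemma address_prob_ge q j :
  (forall t, 0 <= q t <= 1) ->
  (forall i, `|1 - 2 * q (lshift _ i)| <= r) ->
  (2 ^+ d)^-1 * (1 - 2 * eta) <= address_prob q j.
Proof.
move=> q01 qr.
(* All inputs satisfy the bias bound here, so any index may stand for the exceptional one. *)
have := address_prob_near (i0 := Ordinal m_gt0) j q01 (fun i _ => qr i).
have d0 : 0 < 2 ^+ d :> R by rewrite exprn_gt0.
by rewrite ler_norml ler_pdivrMl // => /andP[]; lra.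
Qed.

Lemma influence_slot q j :
  mean (upd q (slot j) true) (fun x => (selector x)%:R) -
  mean (upd q (slot j) false) (fun x => (selector x)%:R) = address_prob q j.
Proof.
rewrite !mean_selector -sumrB (bigD1 j) //= big1 ?addr0 => [|j' jj'].
  by rewrite !address_prob_upd_slot /upd eqxx mul1r mul0r subr0.
rewrite !address_prob_upd_slot /upd eq_rshift (inj_eq enum_rank_inj) (negPf jj').
exact: subrr.
Qed.

Lemma card_slot_notin (s : seq 'I_n) :
  (2 ^ d - size s <= #|[pred j | slot j \notin s]|)%N.
Proof.
have sI : injective slot by move=> j j' /rshift_inj /enum_rank_inj.
have cardV : #|cube d| = (2 ^ d)%N by rewrite card_ffun card_bool card_ord.
have := etrans (cardC [pred j | slot j \in s]) cardV => cardsum.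
have le : (#|[pred j | slot j \in s]| <= size s)%N.
  rewrite cardE -(size_map slot); apply: uniq_leq_size.
    by rewrite map_inj_uniq // enum_uniq.
  by move=> _ /mapP[j + ->]; rewrite mem_enum.
rewrite leq_subLR -cardsum; apply: leq_add le _.
by apply: eq_leq; apply: eq_card.
Qed.

(** At least half of the slots lie outside [s]. Each is addressed with probability at least
    [(1 - 2 * eta) / 2 ^+ d] and takes either value with probability at least [delta]. *)
Lemma selector_balanced q (delta : R) (s : seq 'I_n) :
  0 <= delta -> 2 * eta <= 1 ->
  (forall t, 0 <= q t <= 1) ->
  (forall i, `|1 - 2 * q (lshift _ i)| <= r) ->
  (forall j, slot j \notin s -> delta <= q (slot j) <= 1 - delta) ->
  (2 * size s <= 2 ^ d)%N ->
  delta * (1 - 2 * eta) / 2 <= mean q (fun x => (selector x)%:R)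
    <= 1 - delta * (1 - 2 * eta) / 2.
Proof.
move=> delta0 eta1 q01 qr qs sd; rewrite mean_selector.
have Pge j := address_prob_ge j q01 qr.
have d0 : 0 < 2 ^+ d :> R by rewrite exprn_gt0.
have e0 : 0 <= (2 ^+ d)^-1 * (1 - 2 * eta).
  by rewrite mulr_ge0 ?invr_ge0 ?subr_ge0 // ltW.
have P0 j : 0 <= address_prob q j by apply: le_trans (Pge j).
have key (g : cube d -> R) : (forall j, 0 <= g j) ->
    (forall j, slot j \notin s -> delta <= g j) ->
    delta * (1 - 2 * eta) / 2 <= \sum_j g j * address_prob q j.
  move=> g0 gd; rewrite (bigID [pred j | slot j \notin s]) /=.
  apply: (@le_trans _ _ (\sum_(j | slot j \notin s)
      delta * ((2 ^+ d)^-1 * (1 - 2 * eta)))); last first.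
    rewrite -[X in X <= _]addr0; apply: lerD; last first.
      by apply: sumr_ge0 => j _; rewrite mulr_ge0.
    by apply: ler_sum => j js; apply: ler_pM => //; exact: gd.
  rewrite sumr_const -[X in _ <= X]mulr_natr.
  have : (2 ^ d <= 2 * #|[pred j | slot j \notin s]|)%N.
    by have := card_slot_notin s; lia.
  rewrite -(ler_nat R) natrM natrX; set N := #|_|%:R => HN.
  have -> : delta * ((2 ^+ d)^-1 * (1 - 2 * eta)) * N =
    delta * (1 - 2 * eta) * (N / 2 ^+ d) by ring.
  rewrite ler_wpM2l ?mulr_ge0 ?subr_ge0 // ler_pdivlMr // ler_pdivrMl //.
apply/andP; split.
  by apply: key => j; [case/andP: (q01 (slot j))|move=> /qs /andP[]].
(* The upper bound is the lower bound for the complemented slots, as the address probabilities sum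
   to 1. *)
have := key (fun j => 1 - q (slot j)) _ _.
rewrite (eq_bigr (fun j => address_prob q j - q (slot j) * address_prob q j)).
  rewrite sumrB address_prob_sum => H.
  suff : delta * (1 - 2 * eta) / 2 <=
    1 - \sum_j q (slot j) * address_prob q j by lra.
  by apply: H => j; [have := q01 (slot j)|move=> /qs]; lra.
by move=> j _; ring.
Qed.

End Mixing.
End Selector.

(** * Hardness *)

Definition parity n (x : cube n) : bool := \big[addb/false]_i x i.

Section HardFunctions.
Variable R : realType.

(** Parity is [(1 - s) / 2], where [s] is the product of the signs of the bits. *)
Lemma mean_parity n (q : 'I_n -> R) :
  mean q (fun x => (parity x)%:R) = 2^-1 + - 2^-1 * \prod_i (1 - 2 * q i).
Proof.
rewrite (eq_mean (q := q)
  (h := fun x => 2^-1 + - 2^-1 * \prod_i (-1) ^+ (x i))) // => [|x].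
  rewrite meanD mean_cst meanZ (mean_prod q (fun i b => (-1) ^+ b)).
  congr (_ + _ * _); apply: eq_bigr => i _.
  by rewrite expr0 expr1; ring.
by rewrite -sign_big_addb -/(parity x); case: (parity x) => /=; field.
Qed.

Lemma marginal_balanced n (delta : R) (D : dist R n) i :
  balanced delta D -> delta <= marginal D i <= 1 - delta.
Proof. by move=> [Dp Db]; have := Db i; rewrite marginalE. Qed.

(** Some variable is unqueried at every leaf. Its factor [1 - 2 * p i] keeps the product in
    [mean_parity] within [1 - 2 * delta], hence the mean within [delta] of neither 0 nor 1
    strictly. *)
Lemma parity_hard n (delta : R) (D : dist R n) (T : dtree n) :
  0 < delta <= 2^-1 -> balanced delta D -> (tree_depth T < n)%N ->
  delta <= tree_error D (@parity n) T.
Proof.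
move=> /andP[delta0 delta2] Dbal Tn.
have pd i := marginal_balanced i Dbal.
have p01 i : 0 <= marginal D i <= 1 by have := pd i; lra.
rewrite /tree_error prob_mean; last by case: Dbal.
apply: (@mean_tree_error_ge _ _ _ _ predT n _ _ [::]) => // pi _ pin.
have [i ipi] : exists i, i \notin map fst pi.
  apply/existsP; rewrite -negb_forall; apply/negP => /forallP ipi.
  have := uniq_leq_size (enum_uniq 'I_n) (fun i _ => ipi i).
  by rewrite size_enum_ord size_map leqNgt pin.
rewrite mean_parity (bigD1 i) //= restrict_prob_notin //.
set P := \prod_(_ | _) _.
have : `|P| <= 1.
  rewrite normr_prod; apply: (@le_trans _ _ (\prod_(j < n | j != i) 1)).
    apply: ler_prod => j _; rewrite normr_ge0 ler_norml /=.
    by have := restrict_prob01 pi p01 j; lra.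
  by rewrite big1.
have : `|1 - 2 * marginal D i| <= 1 - 2 * delta.
  by rewrite ler_norml; have := pd i; lra.
move=> H1 H2.
have : `|(1 - 2 * marginal D i) * P| <= (1 - 2 * delta) * 1.
  by rewrite normrM ler_pM.
by rewrite ler_norml; lra.
Qed.

Lemma parity_tree n : exists T : dtree n,
  (forall x, tree_eval T x = parity x) /\ (tree_depth T <= n)%N.
Proof.
have [||T [Te Td]] := @tree_of_queries n (enum 'I_n) (fun x => Leaf (parity x)) 0.
- move=> x y xy; congr Leaf; apply: eq_bigr => i _.
  by apply: xy; rewrite mem_enum.
- by [].
by exists T; split=> //; move: Td; rewrite size_enum_ord addn0.
Qed.

Lemma selector_tree d m (code : 'I_m -> cube d) :
  exists T : dtree (m + #|cube d|),
  (forall x, tree_eval T x = selector code x) /\ (tree_depth T <= m + 1)%N.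
Proof.
have [||T [Te Td]] := @tree_of_queries _ [seq lshift #|cube d| i | i : 'I_m]
  (fun x => Node (slot m (address code x)) (Leaf false) (Leaf true)) 1.
- move=> x y xy; congr (Node (slot m _)); apply/ffunP => l; rewrite !ffunE.
  by apply: eq_bigr => i _; rewrite xy // map_f // mem_enum.
- by [].
exists T; split=> [x|]; first by rewrite Te /=; case: ifP.
by move: Td; rewrite size_map size_enum_ord.
Qed.

(** The numerical gap compares [2 * L * eta ^+ 2], an upper bound on the gain of an address input,
    with [alpha * delta / 16 / (2 ^+ d) ^+ 2], a lower bound on the gain of an unqueried slot. *)
Lemma selector_hard d m (code : 'I_m -> cube d) (N : nat)
    (alpha L delta eta : R) (G : R -> R) (D : dist R (m + #|cube d|))
    (T : dtree (m + #|cube d|)) :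
  0 < alpha -> 0 <= L -> 0 < delta <= 2^-1 -> (0 < m)%N ->
  code_bias code (1 - delta) <= eta -> 4 * eta <= 1 ->
  32 * L * eta ^+ 2 * (2 ^+ d) ^+ 2 < alpha * delta ->
  (2 ^ d = 2 * N)%N ->
  balanced delta D -> smooth_impurity alpha L G ->
  max_gain_tree G D (selector code) T ->
  (tree_depth T < N)%N ->
  delta / 4 <= tree_error D (selector code) T.
Proof.
move=> alpha0 L0 /andP[delta0 delta2] m0 codeH eta4 gap dN Dbal Gimp Tmax TN.
have r_half : 2^-1 <= 1 - delta <= 1 by lra.
have Dprod : product_dist D by case: Dbal.
set p := marginal D.
have pd t : delta <= p t <= 1 - delta := marginal_balanced t Dbal.
have p01 t : 0 <= p t <= 1 by have := pd t; lra.
rewrite /tree_error prob_mean //.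
(* The invariant along a path: only slots have been queried. *)
pose Q (t : 'I_(m + #|cube d|)) := (m <= t)%N.
have notQ (pi : restriction _) i : all (Q \o fst) pi ->
    lshift #|cube d| i \notin map fst pi.
  move=> /allP piQ; apply/mapP => -[c cpi E].
  by have := piQ c cpi; rewrite /Q /= -E /= leqNgt ltn_ord.
have qE (pi : restriction _) i : all (Q \o fst) pi ->
    `|1 - 2 * restrict_prob pi p (lshift _ i)| <= 1 - delta.
  move=> piQ; rewrite restrict_prob_notin ?notQ // ler_norml.
  by have := pd (lshift _ i); lra.
have q01 pi := restrict_prob01 pi p01.
apply: (@mean_tree_error_ge _ _ p _ Q N _ _ [::]) => //.
  move=> pi piQ piN.
  have := @selector_balanced R d m code _ _ r_half codeH m0
    (restrict_prob pi p) delta (map fst pi) (ltW delta0) _ (q01 pi) _ _ _.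
  move=> H.
  suff : delta * (1 - 2 * eta) / 2 <=
    mean (restrict_prob pi p) (fun x => (selector code x)%:R) <= 1 - delta * (1 - 2 * eta) / 2.
    set M := mean _ _ => HM.
    have : delta / 4 <= delta * (1 - 2 * eta) / 2 by nra.
    by move: HM; lra.
  apply: H; [lra|by move=> i; apply: qE| |].
    by move=> j jpi; rewrite restrict_prob_notin.
  by rewrite size_map dN leq_mul2l ltnW.
move=> pi i Hi piQ piN; rewrite /Q leqNgt; apply/negP => im.
have {im}[i0 Ei] : exists i0 : 'I_m, i = lshift _ i0.
  by exists (Ordinal im); apply: val_inj.
move: Hi; rewrite {}Ei => /Tmax Hi.
(* An unqueried slot remains, and its gain will exceed that of the queried address input, against
   maximality. *)
have [j jpi] : exists j, slot m j \notin map fst pi.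
  have /card_gt0P[j] : (0 < #|[pred j | slot m j \notin map fst pi]|)%N.
    apply: leq_trans (card_slot_notin (map fst pi)).
    by rewrite size_map dN subn_gt0 (leq_trans piN) // leq_pmull.
  by exists j.
have := Hi (slot m j); apply/negP; rewrite -ltNge.
rewrite !(purity_gain_restrict Dprod) ?notQ //= -/p.
set q := restrict_prob pi p.
pose a t b := mean (upd q t b) (fun x => (selector code x)%:R).
have upd01 t b t' : 0 <= upd q t b t' <= 1.
  by rewrite /upd; case: ifP => _; [case: b => /=; lra|exact: q01].
have a01 t b : a t b \in `[0, 1] by rewrite in_itv /= mean01.
have p01' t : p t \in `[0, 1] by rewrite in_itv /= p01.
rewrite -!/(a _ _).
have /andP[_] := smooth_impurity_gain Gimp (a01 (lshift _ i0) true)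
  (a01 (lshift _ i0) false) (p01' (lshift _ i0)).
move=> /le_lt_trans; apply.
have /andP[+ _] := smooth_impurity_gain Gimp (a01 (slot m j) true)
  (a01 (slot m j) false) (p01' (slot m j)).
apply: lt_le_trans.
have infl : `|a (lshift _ i0) true - a (lshift _ i0) false| <= 4 * eta.
  by apply: (influence_address r_half codeH) => [t|l]; [exact: q01|exact: qE].
rewrite (_ : a (slot m j) true - _ = address_prob code q j); last first.
  exact: influence_slot.
have d0 : 0 < 2 ^+ d :> R by rewrite exprn_gt0.
have : (2 ^+ d)^-1 * (1 - 2 * eta) <= address_prob code q j.
  by apply: (address_prob_ge r_half codeH m0) => [t|l]; [exact: q01|exact: qE].
set P := address_prob _ _ _; rewrite ler_pdivrMl // => HP.
have eta0 : 0 <= 4 * eta by apply: le_trans infl.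
have infl2 : (a (lshift _ i0) true - a (lshift _ i0) false) ^+ 2 <= (4 * eta) ^+ 2.
  by rewrite -[X in X <= _]real_normK ?num_real // lerXn2r ?nnegrE.
have HP2 : 2^-1 ^+ 2 <= (2 ^+ d * P) ^+ 2.
  by rewrite lerXn2r ?nnegrE //; lra.
(* From [L / 2], a variance [p * (1 - p)] of at most 1/4, and an influence of at most [4 * eta]. *)
apply: (@le_lt_trans _ _ (2 * L * eta ^+ 2)).
  rewrite (_ : 2 * L * eta ^+ 2 = L / 2 * (4^-1 * (4 * eta) ^+ 2)); last by field.
  apply: ler_wpM2l; first by lra.
  apply: ler_pM => //; [by have := p01 (lshift _ i0); nra|exact: sqr_ge0|].
  have : 0 <= (p (lshift _ i0) - 2^-1) ^+ 2 by exact: sqr_ge0.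
  by lra.
rewrite -(ltr_pM2r (exprn_gt0 2 d0)).
(* From [alpha / 2], a variance of at least [delta / 2], and [2 ^+ d * P >= 1/2]. *)
apply: (@lt_le_trans _ _ (alpha * delta / 16)); first by lra.
rewrite (_ : alpha / 2 * _ * _ = alpha / 2 * (p (slot m j) * (1 - p (slot m j)) *
  (2 ^+ d * P) ^+ 2)); last by ring.
rewrite (_ : alpha * delta / 16 = alpha / 2 * (delta / 2 * 2^-1 ^+ 2)); last by field.
apply: ler_wpM2l; first by lra.
apply: ler_pM => //; [lra|].
by have := pd (slot m j); nra.
Qed.

End HardFunctions.

(** * Choice of the parameters *)

Lemma halving_power (R : realType) (x : R) (N : nat) :
  0 <= x <= 1 -> 1 <= N%:R * x -> (1 - x) ^+ N <= 2^-1.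
Proof.
move=> /andP[x0 x1] Nx.
(* By Bernoulli [(1 + x) ^+ N >= 2], while its product with [(1 - x) ^+ N] is at most 1. *)
have bern : 1 + N%:R * x <= (1 + x) ^+ N.
  elim: N {Nx} => [|N IH]; first by rewrite mul0r addr0 expr0.
  rewrite exprS -[N.+1]addn1 natrD.
  have : 0 <= N%:R * x * x by rewrite !mulr_ge0.
  have : (1 + x) * (1 + N%:R * x) <= (1 + x) * (1 + x) ^+ N.
    by rewrite ler_wpM2l //; lra.
  by lra.
have : ((1 - x) * (1 + x)) ^+ N <= 1.
  by rewrite exprn_ile1 //; nra.
rewrite exprMn => prod1.
have a0 : 0 <= (1 - x) ^+ N by rewrite exprn_ge0 // subr_ge0.
have : (1 - x) ^+ N * 2 <= (1 - x) ^+ N * (1 + x) ^+ N.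
  by apply: ler_wpM2l => //; apply: le_trans bern; lra.
by lra.
Qed.

Lemma nat_ltr_expn (R : realType) (X : R) (B : nat) : 2 <= X -> B%:R < X ^+ B.
Proof.
move=> X2; apply: (@lt_le_trans _ _ ((2 ^ B)%:R)).
  by rewrite ltr_nat ltn_expl.
by rewrite natrX lerXn2r ?nnegrE //; lra.
Qed.

Lemma hard_function (R : realType) (alpha L : R) (B : nat) (delta : R) (k : nat) :
  0 < alpha -> 0 <= L -> L < alpha * B%:R -> 0 < delta -> delta <= 2^-1 ->
  (0 < k)%N ->
  exists (n : nat) (f : cube n -> bool),
    (exists T : dtree n, (forall x : cube n, tree_eval T x = f x) /\
       (tree_depth T)%:R <= (3 * (7 + B)%:R + 1) * (k%:R / delta)) /\
    (forall (D : dist R n) (G : R -> R) (T : dtree n),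
       balanced delta D -> smooth_impurity alpha L G -> max_gain_tree G D f T ->
       (2 ^ k <= tree_depth T)%N \/ 4^-1 * delta <= tree_error D f T).
Proof.
move=> alpha0 L0 LB delta0 delta2 k0.
have k1 : 1 <= k%:R :> R by rewrite ler1n.
have kd0 : 0 <= k%:R / delta by rewrite divr_ge0 // ltW.
have [small|large] := leP ((2 ^ k)%:R : R) (k%:R / delta).
  exists (2 ^ k)%N, (@parity (2 ^ k)); split.
    have [T [Te Td]] := parity_tree (2 ^ k); exists T; split=> //.
    apply: (@le_trans _ _ ((2 ^ k)%:R)); first by rewrite ler_nat.
    apply: le_trans small _; rewrite mulrDl mul1r lerDr.
    by apply: mulr_ge0 => //; apply: mulr_ge0.
  move=> D G T Dbal _ _.
  have [Tk|Tk] := leqP (2 ^ k) (tree_depth T); [by left|right].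
  apply: (@le_trans _ _ delta); first by lra.
  by apply: parity_hard => //; rewrite delta0.
(* With [u = 1 / X], the code has bias at most [2 * X * u ^+ A]. One power of [u] cancels [X], six
   serve the numerical constants and the number of slots, and [B] absorb [L / alpha]. *)
pose X : R := 2 ^+ k; pose A := (7 + B)%N.
have X2 : 2 <= X by rewrite /X -[X in X <= _]expr1 ler_weXn2l // ler1n.
have X0 : 0 < X by lra.
have dX : 1 < delta * X.
  move: large; rewrite ltr_pdivrMr // natrX -/X; lra.
(* [N0] factors [1 - delta / 2] multiply to at most 1/2, and [N0 <= 2 / delta + 1 <= 3 / delta]
   gives the 3 in the depth bound. *)
pose N0 := (Num.trunc (2 / delta)).+1.
have N0lb : 1 <= N0%:R * (delta / 2).
  have : 2 / delta < N0%:R by exact: truncnS_gt.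
  by rewrite ltr_pdivrMr //; lra.
have N0ub : N0%:R <= 3 / delta.
  have : (Num.trunc (2 / delta))%:R <= 2 / delta.
    by rewrite truncn_le // divr_ge0 // ltW.
  have : 1 <= delta^-1 by rewrite invf_ge1 //; lra.
  by rewrite /N0 -addn1 natrD; lra.
pose m := (N0 * (A * k))%N.
have m0 : (0 < m)%N by rewrite !muln_gt0 k0.
have r0 : 0 <= 1 - delta by lra.
(* Addresses of [k.+1] bits give [2 * 2 ^ k] slots, so fewer than [2 ^ k] queries leave more than
   half of them untouched. *)
have [code codeH] := exists_code k.+1 m r0.
exists (m + #|cube k.+1|)%N, (selector code); split.
  have [T [Te Td]] := selector_tree code; exists T; split=> //.
  apply: (@le_trans _ _ ((m + 1)%:R)); first by rewrite ler_nat.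
  rewrite natrD mulrDl mul1r; apply: lerD.
    rewrite /m !natrM.
    apply: (@le_trans _ _ (3 / delta * (A%:R * k%:R))).
      by apply: ler_wpM2r => //; rewrite mulr_ge0.
    by rewrite -/A (_ : 3 / delta * _ = 3 * A%:R * (k%:R / delta)) //; ring.
  by rewrite ler_pdivlMr //; lra.
move=> D G T Dbal Gimp Tmax.
have [Tk|Tk] := leqP (2 ^ k) (tree_depth T); [by left|right].
pose u : R := X^-1.
have u0 : 0 < u by rewrite invr_gt0; lra.
have uX : u * X = 1 by rewrite mulVf // gt_eqF //; lra.
have u2 : u <= 2^-1 by nra.
have codeE : code_bias code (1 - delta) <= 2 * u ^+ 6 * u ^+ B.
  apply: le_trans codeH _; rewrite exprS -/X.
  have -> : (1 + (1 - delta)) / 2 = 1 - delta / 2 by field.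
  have -> : 2 * u ^+ 6 * u ^+ B = 2 * X * u ^+ A.
    by rewrite -[LHS]mul1r -[X in X * _ = _]uX /A exprD; ring.
  apply: ler_wpM2l; first by lra.
  rewrite /m exprM /u /X -exprVn -[X in _ <= X]exprM [(k * A)%N]mulnC.
  have half : (1 - delta / 2) ^+ N0 <= 2^-1 by apply: halving_power; lra.
  by rewrite lerXn2r ?nnegrE ?exprn_ge0 //; lra.
have upow n : u ^+ n <= 2^-1 ^+ n by rewrite lerXn2r ?nnegrE //; lra.
have w1 : u ^+ B <= 1 by rewrite exprn_ile1 //; lra.
have w0 : 0 < u ^+ B by rewrite exprn_gt0.
have eta4 : 4 * (2 * u ^+ 6 * u ^+ B) <= 1.
  have u6 : u ^+ 6 * u ^+ B <= 2^-1 ^+ 6 * 1.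
    by apply: ler_pM => //; rewrite ltW // exprn_gt0.
  by lra.
have gap : 32 * L * (2 * u ^+ 6 * u ^+ B) ^+ 2 * (2 ^+ k.+1) ^+ 2 < alpha * delta.
  have Lw : L * u ^+ B <= alpha.
    rewrite /u exprVn ler_pdivrMr ?exprn_gt0 //.
    apply: ltW; apply: lt_le_trans LB _; apply: ler_wpM2l; first exact: ltW.
    exact: ltW (nat_ltr_expn _ X2).
  (* The factor [u ^+ 9 <= 2^-1 ^+ 9] cancels 512, [L * u ^+ B <= alpha], and the remaining [u] is
     below [delta] because [delta * X > 1]. *)
  have -> : 32 * L * (2 * u ^+ 6 * u ^+ B) ^+ 2 * (2 ^+ k.+1) ^+ 2 =
      512 * (u * u ^+ 9) * (u * X) ^+ 2 * (u ^+ B * (L * u ^+ B)).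
    by rewrite (exprS 2 k) -/X; ring.
  rewrite uX expr1n mulr1.
  have u9 : u * u ^+ 9 <= u * 2^-1 ^+ 9 by rewrite ler_wpM2l // ltW.
  have Lww : u ^+ B * (L * u ^+ B) <= 1 * alpha.
    by apply: ler_pM => //; [exact: ltW|rewrite mulr_ge0 // ltW].
  have prod_le : u * u ^+ 9 * (u ^+ B * (L * u ^+ B)) <= u * 2^-1 ^+ 9 * (1 * alpha).
    apply: ler_pM => //; first by rewrite mulr_ge0 ?exprn_ge0 // ltW.
    by rewrite mulr_ge0 ?mulr_ge0 // ltW.
  have ud : u < delta by rewrite /u -[X^-1]mul1r ltr_pdivrMr.
  have au : alpha * u < alpha * delta by rewrite ltr_pM2l.
  by rewrite -[_ * _ * (_ ^+ B * _)]mulrA; lra.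
rewrite mulrC.
apply: (selector_hard alpha0 L0 _ m0 codeE eta4 gap _ Dbal Gimp Tmax Tk).
  by rewrite delta0.
by rewrite expnS.
Qed.


Theorem theorem4 (R : realType) (alpha L : R) (halpha : 0 < alpha)
    (hL : alpha <= L) :
  exists C c : R, 0 < C /\ 0 < c /\
  forall delta : R, 0 < delta -> delta <= 2^-1 ->
  exists (n : nat -> nat) (f : forall k : nat, cube (n k) -> bool),
  forall k : nat, (0 < k)%N ->
    (exists T : dtree (n k),
       (forall x : cube (n k), tree_eval T x = f k x) /\
       (tree_depth T)%:R <= C * (k%:R / delta)) /\
    (forall (D : dist R (n k)) (G : R -> R) (A : learner R),
       balanced delta D -> smooth_impurity alpha L G -> impurity_based G A ->
       (2 ^ k <= tree_depth (A (n k) (f k) D))%N \/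
       c * delta <= tree_error D (f k) (A (n k) (f k) D)).
Proof.
(* [B] depends on [L / alpha] alone, so the constants are uniform in [delta] and [k]. *)
pose B := (Num.trunc (L / alpha)).+1.
have LB : L < alpha * B%:R.
  by rewrite mulrC -ltr_pdivrMr //; exact: truncnS_gt.
have L0 : 0 <= L by apply: le_trans hL; exact: ltW.
exists (3 * (7 + B)%:R + 1), 4^-1; split.
  by rewrite ltr_wpDl // mulr_ge0.
split=> // delta delta0 delta2.
(* The arity and the function are packed in one dependent pair so that a single choice selects
   both. *)
pose hard k (s : {n : nat & cube n -> bool}) := (0 < k)%N ->
  (exists T : dtree (projT1 s), (forall x, tree_eval T x = projT2 s x) /\
     (tree_depth T)%:R <= (3 * (7 + B)%:R + 1) * (k%:R / delta)) /\
  (forall (D : dist R (projT1 s)) (G : R -> R) (T : dtree (projT1 s)),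
     balanced delta D -> smooth_impurity alpha L G ->
     max_gain_tree G D (projT2 s) T ->
     (2 ^ k <= tree_depth T)%N \/ 4^-1 * delta <= tree_error D (projT2 s) T).
have /boolp.choice[F HF] : forall k, exists s, hard k s.
  move=> k; have [k0|k0] := leqP k 0.
    (* A placeholder at [k = 0], where [hard] holds vacuously. *)
    by exists (existT _ 0%N (fun=> false)); rewrite /hard ltnNge k0.
  have [n [f H]] := hard_function halpha L0 LB delta0 delta2 k0.
  by exists (existT _ n f).
exists (fun k => projT1 (F k)), (fun k => projT2 (F k)) => k k0.
have [Ftree Fhard] := HF k k0; split=> // D G A Dbal Gimp AG.
exact: Fhard Dbal Gimp (AG _ _ _).
Qed.
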